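(* Let $\hat G_{x_1y_1}$ and $\hat G_{x_2y_2}$ be radial grid diagrams constructed from Lagrangian grid diagrams $G_{x_1y_1}$ and $G_{x_2y_2}$, and let $\gamma_1:\theta_1\mapsto(x_1(\theta_1),y_1(\theta_1))$ and $\gamma_2:\theta_2\mapsto(x_2(\theta_2),y_2(\theta_2))$ be the (smoothed) immersed loops defined by these radial grid diagrams. Then the immersed torus $f:T^2\to B^2$, $$f(\theta_1,\theta_2)=\left(x_1(\theta_1),y_1(\theta_1),x_2(\theta_2),y_2(\theta_2)\right),$$ lifts to an immersed Legendrian torus $\tilde f:T^2\to S^5\subset\mathbb{C}^3$, $$\tilde f(\theta_1,\theta_2)=e^{it(\theta_1,\theta_2)}\left(x_1(\theta_1),y_1(\theta_1),x_2(\theta_2),y_2(\theta_2),\sqrt{1-x_1^2-y_1^2-x_2^2-y_2^2},0\right),$$ whose cone in $\mathbb{C}^3$ is Lagrangian (as an immersed cone). Here $t(\theta_1,\theta_2)=\int_{f(\gamma)}\tau$ with $\tau=-\sum_{i=1}^2(x_i\,dy_i-y_i\,dx_i)$ and $\gamma$ a path in $T^2$ from a fixed base point to $(\theta_1,\theta_2)$.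
   Context: $B^2$ is the open unit ball in $\mathbb{C}^2=\mathbb{R}^4$, with real coordinates $(x_1,y_1,x_2,y_2)$; $\mathbb{C}^3=\mathbb{R}^6$ has real coordinates $(x_1,y_1,x_2,y_2,x_3,y_3)$, and multiplication by $e^{it}$ is complex scalar multiplication. $S^5$ carries the standard contact form, the restriction of $\frac12\sum_{i=1}^3(x_i\,dy_i-y_i\,dx_i)$. The cone on a subset of $S^5$ is obtained by scaling by all $r>0$. An (immersed, oriented) grid diagram of size $n$ is an $n\times n$ grid of unit cells with markings of two types placed at centers of cells, exactly one marking of each type in each row and each column, at distinct cells. Each row's two markings are joined by a horizontal segment oriented from the first type to the second, and each column's by a vertical segment oriented from the second type to the first, and these form a closed loop. A Lagrangian grid diagram is such a loop $\gamma:S^1\to\mathbb{R}^2$, $\gamma(\theta)=(x(\theta),y(\theta))$, satisfying $\int_0^{2\pi}y(\theta)x'(\theta)\,d\theta=0$ and $\int_{\theta_0}^{\theta_1}y(\theta)x'(\theta)\,d\theta\neq0$ whenever $\gamma(\theta_0)=\gamma(\theta_1)$ and $0<\theta_1-\theta_0<2\pi$. The radial grid diagram constructed from a grid diagram of size $n$: the marking in row $i$ and column $j$ is placed in the plane at the point of polar radius $\sqrt{\frac{i}{3n}}$ and angle $j\frac{2\pi}n$. The markings are joined to match the original grid diagram: a vertical segment becomes the corresponding radial segment, and a horizontal segment from column $j$ to column $j'$ in row $i$ becomes the circular arc of radius $\sqrt{\frac i{3n}}$ from angle $\frac{2\pi j}n$ to angle $\frac{2\pi j'}{n}$ with signed subtended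 angle $\frac{2\pi(j'-j)}n$. Smoothing: the corners of the resulting piecewise smooth loop are rounded to give a smooth immersed loop, $C^0$-close to it and with the same value of the net-area integral $\int r^2\,d\varphi$ over the loop ($r,\varphi$ polar coordinates). *)

(* Defs.v *)
From Stdlib Require Import Reals ZArith.
From mathcomp Require Import all_boot fingroup perm.
From Coquelicot Require Import Coquelicot.

Set Implicit Arguments.
Unset Strict Implicit.
Unset Printing Implicit Defensive.

Local Open Scope R_scope.

(* The two types of markings are X (first) and O (second); [xcol i] and
   [ocol i] are the columns of the markings of row [i].  From the O of row [i]
   the vertical segment leads to the X of the same column, which lies in row
   [xcol^-1 (ocol i)], i.e. the image of [i] under the permutation
   [ocol * xcol^-1]; the segments form one closed loop when this permutation
   has a single orbit.  [start] only fixes where the loop begins. *)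
Record grid (n : nat) := Grid {
  xcol : 'S_n;
  ocol : 'S_n;
  start : 'I_n;
  distinct_cells : forall i, xcol i != ocol i;
  one_loop : forall i, i \in porbit (ocol * xcol^-1)%g start }.

Definition next_row n (G : grid n) : 'S_n := (ocol G * (xcol G)^-1)%g.

(* Row and column of the [k]-th corner along the loop; the sequence has
   period [2 * n]. *)
Definition corner n (G : grid n) (k : nat) : 'I_n * 'I_n :=
  let i := iter k./2 (next_row G) (start G) in
  (i, if odd k then ocol G i else xcol G i).

(* The closed polygon with successive vertices [V 0, ..., V N = V 0],
   parametrized by the circle R / 2 pi Z, each edge having length 2 pi / N in
   the parameter. *)
Definition polygon (N : nat) (V : nat -> R * R) (theta : R) : R * R :=
  let s := INR N * theta / (2 * PI) in
  let k := Z.to_nat (Int_part s mod Z.of_nat N) in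
  let u := frac_part s in
  ((1 - u) * fst (V k) + u * fst (V k.+1),
   (1 - u) * snd (V k) + u * snd (V k.+1)).

(* Rows and columns are numbered from 1 in the plane, while ['I_n] starts at
   0; the cell in row [i] and column [j] is the unit square
   [j - 1, j] x [i - 1, i]. *)
Definition cell_center n (c : 'I_n * 'I_n) : R * R :=
  (INR c.2.+1 - 1 / 2, INR c.1.+1 - 1 / 2).

Definition grid_loop n (G : grid n) : R -> R * R :=
  polygon (2 * n) (fun k => cell_center (corner G k)).

(* [Derive] is irrelevant at the finitely many corners. *)
Definition y_dx (g : R -> R * R) (a b : R) : R :=
  RInt (fun theta => snd (g theta) * Derive (fun s => fst (g s)) theta) a b.

Definition lagrangian_grid n (G : grid n) : Prop :=
  y_dx (grid_loop G) 0 (2 * PI) = 0 /\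
  forall theta0 theta1, 0 < theta1 - theta0 < 2 * PI ->
    grid_loop G theta0 = grid_loop G theta1 ->
    y_dx (grid_loop G) theta0 theta1 <> 0.

Definition polar (p : R * R) : C := (p.1 * cos p.2, p.1 * sin p.2).

Definition radial_vertex n (c : 'I_n * 'I_n) : R * R :=
  (sqrt (INR c.1.+1 / (3 * INR n)), INR c.2.+1 * (2 * PI / INR n)).

(* Interpolating (radius, angle) linearly turns vertical segments into radial
   ones and horizontal segments into arcs of the prescribed signed angle. *)
Definition radial_loop n (G : grid n) (theta : R) : C :=
  polar (polygon (2 * n) (fun k => radial_vertex (corner G k)) theta).

(* r^2 dphi = x dy - y dx *)
Definition net_area (g : R -> C) : R :=
  RInt (fun theta => Re (g theta) * Derive (fun s => Im (g s)) theta
                   - Im (g theta) * Derive (fun s => Re (g s)) theta) 0 (2 * PI).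

Definition smooth_immersed_loop (g : R -> C) : Prop :=
  [/\ forall theta, g (theta + 2 * PI) = g theta,
      forall k theta, ex_derive_n (fun s => Re (g s)) k theta,
      forall k theta, ex_derive_n (fun s => Im (g s)) k theta &
      forall theta, (Derive (fun s => Re (g s)) theta,
                     Derive (fun s => Im (g s)) theta) <> (0, 0)].

Definition circle_reparam (h : R -> R) : Prop :=
  [/\ forall theta, continuous h theta,
      forall a b, a < b -> h a < h b &
      forall theta, h (theta + 2 * PI) = h theta + 2 * PI].

(* [g] is the radial loop of [G] with its corners, which sit at the parameters
   m pi / n, rounded within tolerance [eps]. *)
Definition smoothing n (G : grid n) (eps : R) (g : R -> C) : Prop :=
  [/\ smooth_immersed_loop g,
      exists2 h, circle_reparam h & forall theta,
        Cmod (g theta - radial_loop G (h theta)) < eps /\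
        ((forall m : Z, eps <= Rabs (h theta - IZR m * (PI / INR n))) ->
         g theta = radial_loop G (h theta)) &
      net_area g = net_area (radial_loop G)].

Definition cvec (n : nat) := 'I_n -> C.

Definition sqnorm n (z : cvec n) : R :=
  \big[Rplus/0]_(k < n) (Re (z k) ^ 2 + Im (z k) ^ 2).

(* \sum_k (x_k dy_k - y_k dx_k), at the point [z] on the vector [v] *)
Definition rot_form n (z v : cvec n) : R :=
  \big[Rplus/0]_(k < n) (Re (z k) * Im (v k) - Im (z k) * Re (v k)).

Definition contact_form (z v : cvec 3) : R := 1 / 2 * rot_form z v.

Definition tau (z v : cvec 2) : R := - rot_form z v.

(* \sum_k dx_k /\ dy_k *)
Definition symplectic_form n (v w : cvec n) : R :=
  \big[Rplus/0]_(k < n) (Re (v k) * Im (w k) - Im (v k) * Re (w k)).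

Section Calculus.
Variable V : NormedModule R_AbsRing.

Definition dir_derive (g : V -> R) (v p : V) : R :=
  Derive (fun h : R => g (plus p (scal h v))) 0.

Definition iter_dir_derive (g : V -> R) (vs : seq V) : V -> R :=
  foldr (fun v g' => dir_derive g' v) g vs.

(* For an open [U] in a finite-dimensional [V]: all iterated directional
   derivatives exist and are continuous on [U]. *)
Definition smooth_on (U : V -> Prop) (g : V -> R) : Prop :=
  forall (vs : seq V) (p : V), U p ->
    continuous (iter_dir_derive g vs) p /\
    forall v, ex_derive (fun h : R => iter_dir_derive g vs (plus p (scal h v))) 0.

(* the differential of [F] at [p], applied to [v] *)
Definition tangent_map n (F : V -> cvec n) (p v : V) : cvec n := fun k =>
  (dir_derive (fun q => Re (F q k)) v p, dir_derive (fun q => Im (F q k)) v p).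

Definition immersion_on n (U : V -> Prop) (F : V -> cvec n) : Prop :=
  (forall k, smooth_on U (fun q => Re (F q k)) /\
             smooth_on U (fun q => Im (F q k))) /\
  forall p, U p -> forall v,
    (forall k, tangent_map F p v k = RtoC 0) -> v = zero.

End Calculus.

(* Maps on T^2 = (R / 2 pi Z)^2 are doubly periodic maps on R^2. *)
Definition same_torus_point (p q : R * R) : Prop :=
  exists k l : Z, p = (q.1 + 2 * PI * IZR k, q.2 + 2 * PI * IZR l).

Definition immersed_torus n (F : R * R -> cvec n) : Prop :=
  (forall p q, same_torus_point p q -> F p = F q) /\
  immersion_on (fun _ : R * R => True) F.

Definition legendrian_torus (F : R * R -> cvec 3) : Prop :=
  [/\ immersed_torus F,
      forall p, sqnorm (F p) = 1 &
      forall p v, contact_form (F p) (tangent_map F p v) = 0].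

Definition cone (F : R * R -> cvec 3) (rp : R * (R * R)) : cvec 3 :=
  fun k => (RtoC rp.1 * F rp.2 k)%C.

Definition lagrangian_cone (F : R * R -> cvec 3) : Prop :=
  let U := fun rp : R * (R * R) => 0 < rp.1 in
  immersion_on U (cone F) /\
  forall rp, U rp -> forall v w,
    symplectic_form (tangent_map (cone F) rp v) (tangent_map (cone F) rp w) = 0.

Definition cont_diff (c : R -> R) : Prop :=
  forall s, ex_derive c s /\ continuous (Derive c) s.

Definition piecewise_C1 (c : R -> R * R) : Prop :=
  exists (m : nat) (s : nat -> R) (q : nat -> R -> R * R),
    [/\ s 0%N = 0, s m = 1 & forall k, (k < m)%N ->
      [/\ s k < s k.+1,
          cont_diff (fun u => fst (q k u)), cont_diff (fun u => snd (q k u)) &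
          forall u, s k <= u <= s k.+1 -> c u = q k u]].

(* A path in T^2, given by a lift [0, 1] -> R^2. *)
Definition torus_path (b p : R * R) (c : R -> R * R) : Prop :=
  [/\ piecewise_C1 c, same_torus_point (c 0) b & same_torus_point (c 1) p].

(* [I] is the integral of the 1-form [beta] over the curve [g] on [0, 1]. *)
Definition is_line_integral n (beta : cvec n -> cvec n -> R)
    (g : R -> cvec n) (I : R) : Prop :=
  is_RInt (fun s => beta (g s) (fun k => (Derive (fun u => Re (g u k)) s,
                                          Derive (fun u => Im (g u k)) s)))
          0 1 I.

Definition torus_map (g1 g2 : R -> C) (p : R * R) : cvec 2 :=
  tnth [tuple g1 p.1; g2 p.2].

Definition sphere_section (z : cvec 2) : cvec 3 :=
  tnth [tuple z ord0; z ord_max; RtoC (sqrt (1 - sqnorm z))].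

Definition torus_lift (f : R * R -> cvec 2) (t : R * R -> R) (p : R * R) :
  cvec 3 := fun k => ((cos (t p), sin (t p)) * sphere_section (f p) k)%C.

(* The Hopf projection of S^5 minus {z_3 = 0} onto B^2: each Hopf circle
   e^{is} z is sent to (w_1, w_2), where (w_1, w_2, w_3) is its unique point
   with w_3 > 0. *)
Definition hopf_ball (z : cvec 3) : cvec 2 := fun k =>
  (Cconj (z ord_max) / RtoC (Cmod (z ord_max)) * z (widen_ord (leqnSn 2) k))%C.

Definition lifts (F : R * R -> cvec 3) (f : R * R -> cvec 2) : Prop :=
  forall p, F p ord_max <> RtoC 0 /\ forall k, hopf_ball (F p) k = f p k.

(* Main.v *)
Require Import Defs.
From Stdlib Require Import Reals ZArith Lra Lia FunctionalExtensionality.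
From HB Require Import structures.
From mathcomp Require Import all_boot fingroup perm.
From Coquelicot Require Import Coquelicot.

Local Open Scope R_scope.

(** The pullback of tau to the torus is closed: for a product of two loops it is
    minus the sum of the two area densities [x dy - y dx], each depending on one
    coordinate only.  So its primitive is a sum of two functions of one
    variable, and the only obstruction to descending to the torus is the total
    area of each loop.  Reading a grid diagram edge by edge,
    [net_area] of the radial diagram is the sum of
    [(row / 3n) * (2 pi / n) * (change of column)], while the integral of [y dx]
    over the planar diagram is the sum of
    [(row - 1/2) * (change of column)].  The changes of column sum to zero around
    the loop, so the two are proportional ([radial_net_area]), the Lagrangian
    condition kills both, and smoothing preserves the area.

    Once the phase [t] is a function on the torus with [dt = - omega(f, df)],
    the rest is linear algebra.  On [C^n] the form [sum x dy - y dx] at [z] is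
    [omega(z, .)], for the symplectic form [omega], and it is invariant under
    unit scalars.  Let [S] be the section of the sphere over [f] with positive
    last coordinate.  The differential of [e^{it} S] is [e^{it} (i dt S + dS)],
    and since [S] has norm 1, [omega(S, i dt S) = dt] and [omega(iS, dS)] is, up
    to sign, the inner product of [S] with [dS], which vanishes.  Hence [e^{it} S] is Legendrian and
    pulls [omega] back to the same form as [f], namely zero because each factor
    of [f] is a curve ([rotate_legendrian], [rotate_isotropic]).  The cone over a
    Legendrian map on which [omega] vanishes is Lagrangian by bilinearity
    ([lagrangian_cone_of_legendrian]).  Immersivity goes up from [f] because the
    last coordinate of [S] is real and positive, which forces [dt = 0] on the
    kernel.

    Smoothness in the sense of iterated directional derivatives is handled by
    one principle ([differential_ring_smooth]): if the derivatives of a set of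
    continuous functions lie in the ring that the set generates, then that whole
    ring consists of smooth functions. *)

(** * Smooth functions via differential rings *)
Section SmoothFunctions.

Context {V : NormedModule R_AbsRing}.

Implicit Types (U : V -> Prop) (f g : V -> R) (p v : V).

Definition line (p v : V) (h : R) : V := plus p (scal h v).

Definition line_derivative (U : V -> Prop) (g : V -> R) (v : V) (g' : V -> R) :=
  forall p, U p -> is_derive (fun h : R => g (line p v h)) 0 (g' p).

Lemma line0 p v : line p v 0 = p.
Proof. by rewrite /line (scal_zero_l v) plus_zero_r. Qed.

Lemma near_line (U : V -> Prop) p v : open U -> U p ->
  locally (0 : R) (fun h => U (line p v h)).
Proof.
move=> oU Up; have cl : continuous (line p v) 0.
  apply: continuous_plus; first exact: continuous_const.
  by apply: (@continuous_scal_l _ _ _ (fun h : R => h)); exact: continuous_id.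
by apply: cl; rewrite line0; exact: oU.
Qed.

Lemma line_derivative_unique U g v g' p :
  line_derivative U g v g' -> U p -> dir_derive g v p = g' p.
Proof. by move=> dg Up; apply: is_derive_unique; exact: dg. Qed.

Lemma line_derivative_ext U f g v g' : open U -> (forall p, U p -> f p = g p) ->
  line_derivative U f v g' -> line_derivative U g v g'.
Proof.
move=> oU fg df p Up; apply: is_derive_ext_loc (df p Up).
by apply: filter_imp (near_line U p v oU Up) => h; exact: fg.
Qed.

Lemma line_derivative_plus U f g v f' g' :
  line_derivative U f v f' -> line_derivative U g v g' ->
  line_derivative U (fun p => f p + g p) v (fun p => f' p + g' p).
Proof. by move=> df dg p Up; exact: is_derive_plus (df p Up) (dg p Up). Qed.

Lemma line_derivative_mult U f g v f' g' :
  line_derivative U f v f' -> line_derivative U g v g' ->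
  line_derivative U (fun p => f p * g p) v (fun p => f' p * g p + f p * g' p).
Proof.
move=> df dg p Up.
have := is_derive_mult _ _ _ _ _ (df p Up) (dg p Up) Rmult_comm.
by rewrite line0.
Qed.

Lemma smooth_on_continuous U g p : smooth_on U g -> U p -> continuous g p.
Proof. by move=> sg Up; case: (sg [::] p Up). Qed.

Lemma smooth_on_line_derivative U g v : smooth_on U g ->
  line_derivative U g v (dir_derive g v).
Proof.
by move=> sg p Up; apply: Derive_correct; case: (sg [::] p Up) => _; exact.
Qed.

Lemma smooth_on_dir_derive U g v : smooth_on U g -> smooth_on U (dir_derive g v).
Proof. by move=> sg vs; have := sg (rcons vs v); rewrite /iter_dir_derive foldr_rcons. Qed.

Inductive ring_closure (S : (V -> R) -> Prop) : (V -> R) -> Prop :=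
| RingGen g : S g -> ring_closure S g
| RingConst c : ring_closure S (fun=> c)
| RingPlus f g : ring_closure S f -> ring_closure S g ->
    ring_closure S (fun p => f p + g p)
| RingMult f g : ring_closure S f -> ring_closure S g ->
    ring_closure S (fun p => f p * g p).

(** All iterated derivatives of an element of the ring stay in the ring, so their
    continuity and differentiability reduce to those of the generators.  This
    replaces an induction on the order of differentiation, with a Leibniz or
    Faa di Bruno formula, in each of the closure properties below. *)
Theorem differential_ring_smooth (U : V -> Prop) (S : (V -> R) -> Prop) :
  open U ->
  (forall g, S g -> forall p, U p -> continuous g p) ->
  (forall g, S g -> forall v, exists2 g', ring_closure S g' & line_derivative U g v g') ->
  forall g, ring_closure S g -> smooth_on U g.
Proof.
move=> oU Sc Sd.
have Rc g : ring_closure S g -> forall p, U p -> continuous g p.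
  elim=> [{}g /Sc //|c p _|f {}g _ cf _ cg p Up|f {}g _ cf _ cg p Up].
  - exact: continuous_const.
  - exact: continuous_plus (cf p Up) (cg p Up).
  - exact: continuous_mult (cf p Up) (cg p Up).
have Rd g : ring_closure S g -> forall v,
    exists2 g', ring_closure S g' & line_derivative U g v g'.
  elim=> [{}g /Sd //|c v|f {}g Rf df Rg dg v|f {}g Rf df Rg dg v].
  - exists (fun=> 0); first exact: RingConst.
    by move=> p _; exact: is_derive_const.
  - have [[f' Rf' df'] [g' Rg' dg']] := (df v, dg v).
    by exists (fun p => f' p + g' p); [exact: RingPlus | exact: line_derivative_plus].
  - have [[f' Rf' df'] [g' Rg' dg']] := (df v, dg v).
    exists (fun p => f' p * g p + f p * g' p); last exact: line_derivative_mult.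
    by apply: RingPlus; apply: RingMult.
have iterR g vs : ring_closure S g -> exists2 g', ring_closure S g' &
    forall p, U p -> iter_dir_derive g vs p = g' p.
  move=> Rg; elim: vs => [|v vs [f Rf eqf]]; first by exists g.
  have [f' Rf' df] := Rd f Rf v; exists f' => // p Up.
  apply: line_derivative_unique Up; apply: line_derivative_ext df => // q Uq.
  by rewrite -eqf.
move=> g Rg vs p Up; have [f Rf eqf] := iterR g vs Rg; split.
  apply: continuous_ext_loc (Rc f Rf p Up).
  by apply: filter_imp (oU p Up) => q /eqf.
move=> v; have [f' _ df] := Rd f Rf v; exists (f' p).
by apply: line_derivative_ext df p Up => // q /eqf.
Qed.

Lemma ring_closure_smooth_on (U : V -> Prop) g :
  open U -> ring_closure (smooth_on U) g -> smooth_on U g.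
Proof.
move=> oU; apply: differential_ring_smooth => // {}g sg.
  by move=> p; apply: smooth_on_continuous.
move=> v; exists (dir_derive g v); last exact: smooth_on_line_derivative.
by apply: RingGen; exact: smooth_on_dir_derive.
Qed.

Lemma smooth_on_const (U : V -> Prop) c : open U -> smooth_on U (fun=> c).
Proof. by move=> oU; apply: ring_closure_smooth_on => //; exact: RingConst. Qed.

Lemma smooth_on_plus (U : V -> Prop) f g :
  open U -> smooth_on U f -> smooth_on U g -> smooth_on U (fun p => f p + g p).
Proof.
by move=> oU sf sg; apply: ring_closure_smooth_on => //; apply: RingPlus; exact: RingGen.
Qed.

Lemma smooth_on_mult (U : V -> Prop) f g :
  open U -> smooth_on U f -> smooth_on U g -> smooth_on U (fun p => f p * g p).
Proof.
by move=> oU sf sg; apply: ring_closure_smooth_on => //; apply: RingMult; exact: RingGen.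
Qed.

Lemma smooth_on_ext (U : V -> Prop) f g :
  (forall p, f p = g p) -> smooth_on U f -> smooth_on U g.
Proof. by move=> fg; rewrite (functional_extensionality f g fg). Qed.

Lemma smooth_on_minus (U : V -> Prop) f g :
  open U -> smooth_on U f -> smooth_on U g -> smooth_on U (fun p => f p - g p).
Proof.
move=> oU sf sg; apply: (smooth_on_ext _ (fun p => f p + (-1) * g p)).
  by move=> p; ring.
by apply: smooth_on_plus => //; apply: smooth_on_mult => //; exact: smooth_on_const.
Qed.

(** Used to pass from a function to its primitive: the first derivatives are
    already known to be smooth. *)
Lemma smooth_on_of_derivatives (U : V -> Prop) (g : V -> R) : open U ->
  (forall p, U p -> continuous g p) ->
  (forall v, exists2 g', smooth_on U g' & line_derivative U g v g') ->
  smooth_on U g.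
Proof.
move=> oU cg dg.
apply: (differential_ring_smooth U (fun f => smooth_on U f \/ f = g)) => //; last first.
- by apply: RingGen; right.
- move=> f [sf|->] v.
    exists (dir_derive f v); last exact: smooth_on_line_derivative.
    by apply: RingGen; left; exact: smooth_on_dir_derive.
  by have [g' sg' dg'] := dg v; exists g' => //; apply: RingGen; left.
by move=> f [sf|->] // p; apply: smooth_on_continuous.
Qed.

End SmoothFunctions.

Local Notation smooth_onR := (smooth_on (V := R_NormedModule)).

Lemma line_R (x v h : R) : line (V := R_NormedModule) x v h = x + h * v.
Proof. by []. Qed.

Lemma is_derive_line_derivative (U : R -> Prop) (f : R -> R) (f' : R -> R) v :
  (forall x, U x -> is_derive f x (f' x)) ->
  line_derivative (V := R_NormedModule) U f v (fun x => v * f' x).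
Proof.
move=> df x Ux; apply: (is_derive_comp f (line (V := R_NormedModule) x v)).
  by rewrite line0; exact: df.
by rewrite /line /plus /scal /= /mult /=; auto_derive => //; ring.
Qed.

Lemma smooth_on_is_derive (D : R -> Prop) (f : R -> R) x :
  smooth_onR D f -> D x ->
  is_derive f x (dir_derive (V := R_NormedModule) f 1 x).
Proof.
move=> sf Dx.
have := smooth_on_line_derivative (V := R_NormedModule) D f 1 sf x Dx.
move=> df.
have {}df : is_derive (fun h : R => f (line (V := R_NormedModule) x 1 h)) (x - x)
  (dir_derive (V := R_NormedModule) f 1 x) by rewrite Rminus_diag.
have := is_derive_comp _ (fun y => y - x) x _ 1 df.
rewrite scal_one => dc; apply: is_derive_ext (dc _).
  by move=> y; rewrite line_R; congr f; ring.
by auto_derive => //; ring.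
Qed.

(** The generators are the smooth functions together with all [psi \o g], [psi]
    smooth: by the chain rule they are closed under differentiation up to
    products. *)
Lemma smooth_on_comp {V : NormedModule R_AbsRing} (U : V -> Prop) (D : R -> Prop)
    (phi : R -> R) (g : V -> R) :
  open U -> smooth_onR D phi -> smooth_on U g ->
  (forall p, U p -> D (g p)) -> smooth_on U (fun p => phi (g p)).
Proof.
move=> oU sphi sg UD.
apply: (differential_ring_smooth U (fun f => smooth_on U f \/
  exists2 psi, smooth_onR D psi & f = fun p => psi (g p))) => //; last first.
- by apply: RingGen; right; exists phi.
- move=> f [sf|[psi spsi ->]] v.
    exists (dir_derive f v); last exact: smooth_on_line_derivative.
    by apply: RingGen; left; exact: smooth_on_dir_derive.
  exists (fun p => dir_derive g v p * dir_derive (V := R_NormedModule) psi 1 (g p)).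
    apply: RingMult; apply: RingGen; first by left; exact: smooth_on_dir_derive.
    by right; exists (dir_derive (V := R_NormedModule) psi 1) => //; exact: smooth_on_dir_derive.
  move=> p Up; apply: (is_derive_comp psi).
    by rewrite line0; apply: (smooth_on_is_derive D) => //; exact: UD.
  exact: (smooth_on_line_derivative U g v sg p Up).
move=> f [sf|[psi spsi ->]] p Up; first exact: smooth_on_continuous sf Up.
apply: continuous_comp; first exact: smooth_on_continuous sg Up.
by apply: (smooth_on_continuous D) => //; exact: UD.
Qed.

Lemma linear_line {V W : NormedModule R_AbsRing} (L : V -> W) p v h :
  is_linear L -> L (line p v h) = line (L p) (L v) h.
Proof. by move=> linL; rewrite /line linear_plus // linear_scal. Qed.

(** A linear map carries lines to lines, so no chain rule is involved: the
    directions are just pushed forward. *)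
Lemma iter_dir_derive_linear {V W : NormedModule R_AbsRing} (L : V -> W)
    (g : W -> R) (vs : seq V) p : is_linear L ->
  iter_dir_derive (fun q => g (L q)) vs p = iter_dir_derive g (map L vs) (L p).
Proof.
move=> linL; elim: vs p => [|v vs IH] p //=.
by apply: Derive_ext => h; rewrite IH (linear_line L p v h).
Qed.

Lemma smooth_on_linear {V W : NormedModule R_AbsRing} (U : V -> Prop) (D : W -> Prop)
    (L : V -> W) (g : W -> R) :
  is_linear L -> smooth_on D g -> (forall p, U p -> D (L p)) ->
  smooth_on U (fun p => g (L p)).
Proof.
move=> linL sg UD vs p Up; have [cg dg] := sg (map L vs) (L p) (UD p Up).
split=> [|v].
  apply: (continuous_ext (fun q => iter_dir_derive g (map L vs) (L q))).
    by move=> q; rewrite (iter_dir_derive_linear L g vs q linL).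
  exact: continuous_comp L _ p (linear_cont L p linL) cg.
apply: ex_derive_ext (dg (L v)) => h /=.
by rewrite (iter_dir_derive_linear L g vs _ linL) (linear_plus L linL) (linear_scal L linL).
Qed.

Lemma smooth_on_ex_derive_n (f : R -> R) :
  (forall k x, ex_derive_n f k x) ->
  smooth_onR (fun _ => True) f.
Proof.
move=> df.
apply: (differential_ring_smooth (V := R_NormedModule) _
  (fun g => exists k, g = Derive_n f k)); first exact: open_true.
- by move=> _ [k ->] x _; apply: ex_derive_continuous; exact: (df k.+1).
- move=> _ [k ->] v; exists (fun x => v * Derive_n f k.+1 x).
    apply: RingMult; first exact: RingConst.
    by apply: RingGen; exists k.+1.
  by apply: is_derive_line_derivative => x _; apply: Derive_correct; exact: (df k.+1).
- by apply: RingGen; exists 0%N.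
Qed.

Lemma smooth_on_derive (f : R -> R) :
  (forall k x, ex_derive_n f k x) ->
  smooth_onR (fun _ => True) (Derive f).
Proof.
move=> df; apply: smooth_on_ex_derive_n => -[|k] x //=.
apply: (ex_derive_ext (Derive_n f k.+1)); last exact: (df k.+2).
by move=> y; rewrite -[Derive f]/(Derive_n f 1) Derive_n_comp Nat.add_1_r.
Qed.

Lemma smooth_on_cos_sin :
  smooth_onR (fun _ => True) cos /\
  smooth_onR (fun _ => True) sin.
Proof.
have main f : ring_closure (V := R_NormedModule) (fun g => g = cos \/ g = sin) f ->
    smooth_onR (fun _ => True) f.
  apply: differential_ring_smooth; first exact: open_true.
    move=> _ [|] -> x _; [exact: continuous_cos | exact: continuous_sin].
  move=> _ [|] -> v.
    exists (fun x => v * (-1 * sin x)).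
      apply: RingMult; first exact: RingConst.
      apply: RingMult; [exact: RingConst | by apply: RingGen; right].
    apply: (is_derive_line_derivative _ _ (fun x => -1 * sin x)) => x _.
    by rewrite -Ropp_mult_distr_l Rmult_1_l; exact: is_derive_cos.
  exists (fun x => v * cos x).
    by apply: RingMult; [exact: RingConst | apply: RingGen; left].
  by apply: is_derive_line_derivative => x _; exact: is_derive_sin.
by split; apply/main/RingGen; [left | right].
Qed.

(** [sqrt] alone does not generate a differential ring, but [sqrt] and its
    inverse do. *)
Lemma smooth_on_sqrt : smooth_onR (fun x => 0 < x) sqrt.
Proof.
apply: (differential_ring_smooth (V := R_NormedModule) _
  (fun g => g = sqrt \/ g = fun x => / sqrt x)); first exact: open_gt.
- move=> _ [|] -> x x0; first exact: continuous_sqrt.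
  apply: continuous_Rinv_comp; first exact: continuous_sqrt.
  by have := sqrt_lt_R0 x x0; lra.
- have inv : ring_closure (V := R_NormedModule) (fun g => g = sqrt \/ g = fun x => / sqrt x)
      (fun x => / sqrt x) by apply: RingGen; right.
  move=> _ [|] -> v.
    exists (fun x => v * (1 / 2 * / sqrt x)).
      by do 2!(apply: RingMult; first exact: RingConst).
    apply: (is_derive_line_derivative _ _ (fun x => 1 / 2 * / sqrt x)) => x x0.
    have s0 := sqrt_lt_R0 x x0.
    by auto_derive => //; field; lra.
  exists (fun x => v * (- (1 / 2) * (/ sqrt x * (/ sqrt x * / sqrt x)))).
    by do 2!(apply: RingMult; first exact: RingConst); do 2!apply: RingMult => //.
  apply: (is_derive_line_derivative _ _
    (fun x => - (1 / 2) * (/ sqrt x * (/ sqrt x * / sqrt x)))) => x x0.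
  have s0 := sqrt_lt_R0 x x0.
  by auto_derive; [split=> //; split=> //; lra | field; lra].
- by apply: RingGen; left.
Qed.

Lemma line_derivative_linear {V : NormedModule R_AbsRing} (U : V -> Prop)
    (L : V -> R) v : is_linear L -> line_derivative U L v (fun=> L v).
Proof.
move=> linL p _; apply: (is_derive_ext (fun h : R => L p + h * L v)).
  by move=> h; rewrite (linear_line L p v h linL).
by auto_derive => //; ring.
Qed.

Lemma smooth_on_linear_form {V : NormedModule R_AbsRing} (U : V -> Prop) (L : V -> R) :
  open U -> is_linear L -> smooth_on U L.
Proof.
move=> oU linL; apply: smooth_on_of_derivatives => // [p _|v].
  exact: linear_cont.
by exists (fun=> L v); [exact: smooth_on_const | exact: line_derivative_linear].
Qed.

(** * Symplectic algebra in complex space *)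
HB.instance Definition _ := Monoid.isComLaw.Build R 0 Rplus
  (fun x y z => esym (Rplus_assoc x y z)) Rplus_comm Rplus_0_l.

Definition inner {n} (z v : cvec n) : R :=
  \big[Rplus/0]_(k < n) (Re (z k) * Re (v k) + Im (z k) * Im (v k)).

Definition comb {n} (a : R) (v : cvec n) (b : R) (w : cvec n) : cvec n :=
  fun k => (RtoC a * v k + RtoC b * w k)%C.

Definition itimes {n} (z : cvec n) : cvec n := fun k => (Ci * z k)%C.

Definition phase {n} (s : R) (z : cvec n) : cvec n :=
  fun k => ((cos s, sin s) * z k)%C.

Lemma sum_scal n (a : R) (F : 'I_n -> R) :
  a * (\big[Rplus/0]_(k < n) F k) = \big[Rplus/0]_(k < n) (a * F k).
Proof. by elim/big_rec2: _ => [|k x y _ <-]; ring. Qed.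

Lemma sum_opp n (F : 'I_n -> R) :
  - (\big[Rplus/0]_(k < n) F k) = \big[Rplus/0]_(k < n) (- F k).
Proof. by elim/big_rec2: _ => [|k x y _ <-]; ring. Qed.

Section SymplecticAlgebra.

Context {n : nat}.
Implicit Types z v w : cvec n.

Lemma symplectic_ext v v' w w' : v =1 v' -> w =1 w' ->
  symplectic_form v w = symplectic_form v' w'.
Proof. by move=> ev ew; apply: eq_bigr => k _; rewrite ev ew. Qed.

Lemma symplectic_antisym v w : symplectic_form v w = - symplectic_form w v.
Proof. by rewrite /symplectic_form sum_opp; apply: eq_bigr => k _; ring. Qed.

Lemma symplectic_self v : symplectic_form v v = 0.
Proof. by have := symplectic_antisym v v; lra. Qed.

(** The form [rot_form z v] and [symplectic_form z v] are the same expression, so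
    this bilinearity serves for the contact form as well. *)
Lemma symplectic_comb a v b v' c w d w' :
  symplectic_form (comb a v b v') (comb c w d w') =
  a * c * symplectic_form v w + a * d * symplectic_form v w'
  + b * c * symplectic_form v' w + b * d * symplectic_form v' w'.
Proof.
rewrite /symplectic_form !sum_scal -!big_split /=; apply: eq_bigr => k _ /=.
by rewrite /comb /Re /Im /=; ring.
Qed.

Lemma inner_combr z a v b w :
  inner z (comb a v b w) = a * inner z v + b * inner z w.
Proof.
rewrite /inner !sum_scal -!big_split /=; apply: eq_bigr => k _ /=.
by rewrite /comb /Re /Im /=; ring.
Qed.

Lemma inner_self z : inner z z = sqnorm z.
Proof. by apply: eq_bigr => k _; ring. Qed.

Lemma symplectic_itimesr z v : symplectic_form z (itimes v) = inner z v.
Proof. by apply: eq_bigr => k _; rewrite /itimes /Re /Im /=; ring. Qed.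

Lemma symplectic_itimesl z v : symplectic_form (itimes z) v = - inner z v.
Proof. by rewrite /inner sum_opp; apply: eq_bigr => k _; rewrite /itimes /Re /Im /=; ring. Qed.

Lemma cos2_sin2 s : cos s * cos s + sin s * sin s = 1.
Proof. by have := sin2_cos2 s; rewrite /Rsqr; lra. Qed.

Lemma symplectic_phase s v w :
  symplectic_form (phase s v) (phase s w) = symplectic_form v w.
Proof.
apply: eq_bigr => k _; rewrite /phase /Re /Im /=.
rewrite -[RHS]Rmult_1_l -(cos2_sin2 s); ring.
Qed.

Lemma sqnorm_phase s z : sqnorm (phase s z) = sqnorm z.
Proof.
apply: eq_bigr => k _; rewrite /phase /Re /Im /=.
rewrite -[RHS]Rmult_1_l -(cos2_sin2 s); ring.
Qed.

Lemma phase_eq0 s z k : phase s z k = RtoC 0 -> z k = RtoC 0.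
Proof.
rewrite /phase; case: (z k) => a b; rewrite /Cmult /= => -[e1 e2].
congr pair; rewrite -[LHS]Rmult_1_l -(cos2_sin2 s).
  transitivity (cos s * (cos s * a - sin s * b) + sin s * (cos s * b + sin s * a)).
    by ring.
  by rewrite e1 e2; ring.
transitivity (cos s * (cos s * b + sin s * a) - sin s * (cos s * a - sin s * b)).
  by ring.
by rewrite e1 e2; ring.
Qed.

End SymplecticAlgebra.

(** * Differentials of maps into complex space *)
Definition smooth_map {V : NormedModule R_AbsRing} {n} (U : V -> Prop) (F : V -> cvec n) :=
  forall k, smooth_on U (fun p => Re (F p k)) /\ smooth_on U (fun p => Im (F p k)).

Section TangentVectors.

Context {V : NormedModule R_AbsRing} {n : nat}.
Implicit Types (U : V -> Prop) (F : V -> cvec n) (t : V -> R).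

Lemma tangent_map_line U F v : smooth_map U F -> forall k,
  line_derivative U (fun p => Re (F p k)) v (fun p => Re (tangent_map F p v k)) /\
  line_derivative U (fun p => Im (F p k)) v (fun p => Im (tangent_map F p v k)).
Proof. by move=> sF k; split; apply: smooth_on_line_derivative; case: (sF k). Qed.

Lemma is_derive_sum (g : 'I_n -> R -> R) (g' : 'I_n -> R) x :
  (forall k, is_derive (g k) x (g' k)) ->
  is_derive (fun y => \big[Rplus/0]_(k < n) g k y) x (\big[Rplus/0]_(k < n) g' k).
Proof.
move=> dg; rewrite unlock; elim: (index_enum _) => [|k s IH] /=.
  exact: is_derive_const.
exact: is_derive_plus (dg k) IH.
Qed.

(** The squared norm is constant along [F], and its derivative is twice the inner
    product. *)
Lemma inner_tangent_sphere U F c p v : open U -> smooth_map U F ->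
  (forall q, U q -> sqnorm (F q) = c) -> U p ->
  inner (F p) (tangent_map F p v) = 0.
Proof.
move=> oU sF F1 Up.
suff d : line_derivative U (fun q => sqnorm (F q)) v
           (fun q => 2 * inner (F q) (tangent_map F q v)).
  suff : 2 * inner (F p) (tangent_map F p v) = 0 by lra.
  rewrite -(line_derivative_unique _ _ _ _ _ d Up).
  apply: (line_derivative_unique U) Up.
  apply: (line_derivative_ext U (fun=> c)) => // [q /F1 //|q _].
  exact: is_derive_const.
move=> q Uq; rewrite /inner sum_scal; apply: is_derive_sum => k.
have [dRe dIm] := tangent_map_line U F v sF k.
have := line_derivative_plus _ _ _ _ _ _
  (line_derivative_mult _ _ _ _ _ _ dRe dRe) (line_derivative_mult _ _ _ _ _ _ dIm dIm).
move=> /(_ q Uq); rewrite /=.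
set l := (X in is_derive _ _ X -> _) => D.
have -> : 2 * (Re (F q k) * dir_derive (fun p => Re (F p k)) v q +
  Im (F q k) * dir_derive (fun p => Im (F p k)) v q) = l by rewrite /l; ring.
by apply: is_derive_ext D => h; rewrite !Rmult_1_r.
Qed.

Definition rotate t F : V -> cvec n := fun p => phase (t p) (F p).

Lemma smooth_map_rotate U t F : open U -> smooth_on U t -> smooth_map U F ->
  smooth_map U (rotate t F).
Proof.
move=> oU st sF k; have [sRe sIm] := sF k; have [sc ss] := smooth_on_cos_sin.
have sct : smooth_on U (fun p => cos (t p)) by exact: smooth_on_comp sc st _.
have sst : smooth_on U (fun p => sin (t p)) by exact: smooth_on_comp ss st _.
by split; [apply: smooth_on_minus | apply: smooth_on_plus] => //; exact: smooth_on_mult.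
Qed.

(** The product rule [d(e^{it} F) = e^{it} (i dt F + dF)]. *)
Lemma tangent_rotate U t F p v : open U -> smooth_on U t -> smooth_map U F -> U p ->
  tangent_map (rotate t F) p v =1
  phase (t p) (comb (dir_derive t v p) (itimes (F p)) 1 (tangent_map F p v)).
Proof.
move=> oU st sF Up k; have [dRe dIm] := tangent_map_line U F v sF k.
have dt := smooth_on_line_derivative U t v st.
have dc : line_derivative U (fun p => cos (t p)) v
    (fun p => dir_derive t v p * (- sin (t p))).
  move=> q Uq; apply: (is_derive_comp cos); last exact: dt.
  by rewrite line0; exact: is_derive_cos.
have ds : line_derivative U (fun p => sin (t p)) v
    (fun p => dir_derive t v p * cos (t p)).
  move=> q Uq; apply: (is_derive_comp sin); last exact: dt.
  by rewrite line0; exact: is_derive_sin.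
have dm : line_derivative U (fun p => - sin (t p)) v
    (fun p => - (dir_derive t v p * cos (t p))).
  by move=> q Uq; apply: is_derive_opp; exact: ds.
rewrite /tangent_map; congr pair.
  apply: etrans (line_derivative_unique _ _ _ _ _ (line_derivative_ext U _ _ _ _ oU _
   (line_derivative_plus _ _ _ _ _ _ (line_derivative_mult _ _ _ _ _ _ dc dRe)
      (line_derivative_mult _ _ _ _ _ _ dm dIm))) Up) _.
    by move=> q _; rewrite /rotate /phase /Re /Im /=; ring.
  by rewrite /phase /comb /itimes /tangent_map /Re /Im /=; ring.
apply: etrans (line_derivative_unique _ _ _ _ _ (line_derivative_ext U _ _ _ _ oU _
   (line_derivative_plus _ _ _ _ _ _ (line_derivative_mult _ _ _ _ _ _ dc dIm)
      (line_derivative_mult _ _ _ _ _ _ ds dRe))) Up) _.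
  by move=> q _; rewrite /rotate /phase /Re /Im /=; ring.
by rewrite /phase /comb /itimes /tangent_map /Re /Im /=; ring.
Qed.

(** Turning [F] by the phase adds [omega(F, i dt F) = dt |F|^2] to the form, so
    the phase can be chosen to cancel it. *)
Lemma rotate_legendrian U t F p v : open U -> smooth_on U t -> smooth_map U F ->
  (forall q, U q -> sqnorm (F q) = 1) -> U p ->
  dir_derive t v p = - symplectic_form (F p) (tangent_map F p v) ->
  symplectic_form (rotate t F p) (tangent_map (rotate t F) p v) = 0.
Proof.
move=> oU st sF F1 Up dt.
rewrite (symplectic_ext _ _ _ _ (fun=> erefl) (tangent_rotate U t F p v oU st sF Up)).
rewrite symplectic_phase.
have -> : symplectic_form (F p)
    (comb (dir_derive t v p) (itimes (F p)) 1 (tangent_map F p v)) =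
    symplectic_form (comb 1 (F p) 0 (F p))
    (comb (dir_derive t v p) (itimes (F p)) 1 (tangent_map F p v)).
  by apply: symplectic_ext => // k; rewrite /comb; ring.
rewrite symplectic_comb symplectic_itimesr inner_self F1 // dt; ring.
Qed.

(** In [omega(i a F + dF v, i b F + dF w)] the cross terms are inner products of
    [F] with its differential, which vanish on a sphere. *)
Lemma rotate_isotropic U t F p v w : open U -> smooth_on U t -> smooth_map U F ->
  (forall q, U q -> sqnorm (F q) = 1) -> U p ->
  symplectic_form (tangent_map (rotate t F) p v) (tangent_map (rotate t F) p w) =
  symplectic_form (tangent_map F p v) (tangent_map F p w).
Proof.
move=> oU st sF F1 Up.
rewrite (symplectic_ext _ _ _ _ (tangent_rotate U t F p v oU st sF Up)
  (tangent_rotate U t F p w oU st sF Up)) symplectic_phase symplectic_comb.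
rewrite symplectic_self symplectic_itimesl.
rewrite (symplectic_antisym (tangent_map F p v) (itimes _)) symplectic_itimesl.
by rewrite !(inner_tangent_sphere U F 1) //; ring.
Qed.

End TangentVectors.

(** * Cones over Legendrian tori *)
Lemma open_first_positive : open (fun rp : R * (R * R) => 0 < rp.1).
Proof.
apply: (open_comp fst (fun x : R => 0 < x)); last exact: open_gt.
by move=> x _; exact: continuous_fst.
Qed.

Section Cone.

Context (F : R * R -> cvec 3) (sF : smooth_map (fun _ => True) F).

Lemma smooth_map_cone (U : R * (R * R) -> Prop) : open U -> smooth_map U (cone F).
Proof.
move=> oU k; have [sRe sIm] := sF k.
have s1 : smooth_on U (fun rp => rp.1).
  exact: (smooth_on_linear_form U fst oU is_linear_fst).
have sRe2 := smooth_on_linear U (fun _ => True) snd _ is_linear_snd sRe (fun _ _ => I).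
have sIm2 := smooth_on_linear U (fun _ => True) snd _ is_linear_snd sIm (fun _ _ => I).
split; last first.
  apply: smooth_on_ext (smooth_on_mult _ _ _ oU s1 sIm2).
  by move=> rp; rewrite /cone /Re /Im /=; ring.
apply: smooth_on_ext (smooth_on_mult _ _ _ oU s1 sRe2).
by move=> rp; rewrite /cone /Re /Im /=; ring.
Qed.

Lemma tangent_cone (rp av : R * (R * R)) :
  tangent_map (cone F) rp av =1
  comb av.1 (F rp.2) rp.1 (tangent_map F rp.2 av.2).
Proof.
move=> k; have [dRe dIm] := tangent_map_line _ F av.2 sF k.
have d1 : line_derivative (fun _ => True) fst av (fun=> av.1).
  exact: line_derivative_linear is_linear_fst.
have dRe2 : line_derivative (fun _ => True) (fun q => Re (F q.2 k)) av
    (fun q => Re (tangent_map F q.2 av.2 k)) by move=> q _; exact: dRe.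
have dIm2 : line_derivative (fun _ => True) (fun q => Im (F q.2 k)) av
    (fun q => Im (tangent_map F q.2 av.2 k)) by move=> q _; exact: dIm.
rewrite /tangent_map; congr pair.
  apply: etrans (line_derivative_unique _ _ _ _ rp (line_derivative_ext _ _ _ _ _ open_true _
   (line_derivative_mult _ _ _ _ _ _ d1 dRe2)) I) _.
    by move=> q _; rewrite /cone /Re /Im /=; ring.
  by rewrite /comb /tangent_map /Re /Im /=; ring.
apply: etrans (line_derivative_unique _ _ _ _ rp (line_derivative_ext _ _ _ _ _ open_true _
   (line_derivative_mult _ _ _ _ _ _ d1 dIm2)) I) _.
  by move=> q _; rewrite /cone /Re /Im /=; ring.
by rewrite /comb /tangent_map /Re /Im /=; ring.
Qed.

End Cone.

(** The differential of [r F] is [dr F + r dF].  The radial part is orthogonal to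
    the tangential one, which gives immersivity; it is also symplectically
    orthogonal to it, which is the Legendrian condition, so that [omega] on the
    cone reduces to [omega] on the differential of [F]. *)
Theorem lagrangian_cone_of_legendrian (F : R * R -> cvec 3) :
  legendrian_torus F ->
  (forall p v w, symplectic_form (tangent_map F p v) (tangent_map F p w) = 0) ->
  lagrangian_cone F.
Proof.
move=> [[_ [sF immF]] F1 Fleg] Fiso.
have leg p v : symplectic_form (F p) (tangent_map F p v) = 0.
  have := Fleg p v; rewrite /contact_form -[rot_form _ _]/(symplectic_form (F p) _).
  lra.
have rad p v : inner (F p) (tangent_map F p v) = 0.
  by apply: (inner_tangent_sphere (fun _ => True) F 1) => //; exact: open_true.
split.
  split=> [k|[r p] /= r0 [a v] T0].
    exact: smooth_map_cone open_first_positive k.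
  have {}T0 k := etrans (esym (tangent_cone F sF (r, p) (a, v) k)) (T0 k).
  (* the inner product with [F p] kills the tangential part and returns [a] *)
  have a0 : a = 0.
    have : inner (F p) (comb a (F p) r (tangent_map F p v)) = 0.
      by apply: big1 => k _; rewrite [comb _ _ _ _ _]T0 /=; ring.
    by rewrite inner_combr inner_self F1 rad; lra.
  have -> : v = zero.
    apply: (immF p I) => k; have := T0 k; rewrite /comb /= a0.
    case: (tangent_map F p v k) => x y; rewrite /RtoC /Cmult /Cplus /= => -[ex ey].
    by congr pair; apply: (Rmult_eq_reg_l r); lra.
  by rewrite a0.
move=> [r p] /= r0 [a v] [b w].
rewrite (symplectic_ext _ _ _ _ (tangent_cone F sF (r, p) (a, v))
  (tangent_cone F sF (r, p) (b, w))) symplectic_comb /=.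
by rewrite symplectic_self leg Fiso symplectic_antisym leg; ring.
Qed.

(** * The Legendrian lift of an isotropic torus *)
Section SphereSection.

Lemma ord3_cases (k : 'I_3) :
  (exists j : 'I_2, k = widen_ord (leqnSn 2) j) \/ k = ord_max.
Proof.
case: (ltnP k 2) => [k2|]; first by left; exists (Ordinal k2); exact: val_inj.
by right; apply/val_inj/eqP; rewrite /= eqn_leq -ltnS ltn_ord.
Qed.

Lemma ord2_cases (k : 'I_2) : k = ord0 \/ k = ord_max.
Proof. by case: k => [[|[|//]] lt]; [left | right]; exact: val_inj. Qed.

Lemma sphere_section_widen z (j : 'I_2) :
  sphere_section z (widen_ord (leqnSn 2) j) = z j.
Proof. by case: (ord2_cases j) => ->. Qed.

Lemma sphere_section_max z : sphere_section z ord_max = RtoC (sqrt (1 - sqnorm z)).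
Proof. by []. Qed.

Context (f : R * R -> cvec 2).
Context (sf : smooth_map (fun _ => True) f) (f1 : forall p, sqnorm (f p) < 1).

Let S p := sphere_section (f p).

Lemma sqnorm_sphere_section p : sqnorm (S p) = 1.
Proof.
rewrite /sqnorm big_ord_recr.
under eq_bigr do rewrite /S sphere_section_widen.
rewrite -[\big[_/_]_(_ < _) _]/(sqnorm (f p)) /S sphere_section_max /= Rmult_1_r.
by rewrite sqrt_sqrt; [ring | have := f1 p; lra].
Qed.

Lemma smooth_on_sqnorm : smooth_on (fun _ => True) (fun p => sqnorm (f p)).
Proof.
apply: (smooth_on_ext _ (fun p => (Re (f p ord0) * Re (f p ord0) + Im (f p ord0) * Im (f p ord0))
   + (Re (f p ord_max) * Re (f p ord_max) + Im (f p ord_max) * Im (f p ord_max)))).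
  move=> p; rewrite /sqnorm 2!big_ord_recr big_ord0 /=.
  by rewrite (_ : widen_ord _ _ = ord0); [ring | exact: val_inj].
have oT := @open_true (prod_NormedModule _ R_NormedModule R_NormedModule).
have [[sRe0 sIm0] [sRe1 sIm1]] := (sf ord0, sf ord_max).
by do !apply: smooth_on_plus => //; apply: smooth_on_mult.
Qed.

Lemma smooth_map_sphere_section : smooth_map (fun _ => True) S.
Proof.
move=> k; have oT := @open_true (prod_NormedModule _ R_NormedModule R_NormedModule).
case: (ord3_cases k) => [[j ->]|->].
  have [sRe sIm] := sf j.
  split; [apply: smooth_on_ext sRe | apply: smooth_on_ext sIm] => p;
    by rewrite /S sphere_section_widen.
split; last exact: smooth_on_const.
apply: (smooth_on_comp _ (fun x => 0 < x) sqrt _ oT smooth_on_sqrt).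
  by apply: smooth_on_minus => //; [exact: smooth_on_const | exact: smooth_on_sqnorm].
by move=> p _; have := f1 p; lra.
Qed.

Lemma tangent_sphere_section_widen p v j :
  tangent_map S p v (widen_ord (leqnSn 2) j) = tangent_map f p v j.
Proof.
by rewrite /tangent_map /S; congr pair; apply: Derive_ext => h; rewrite sphere_section_widen.
Qed.

(** The last coordinate of the section is real; hence it contributes nothing to
    the symplectic form, and the pullbacks from [C^3] and [C^2] agree. *)
Lemma tangent_sphere_section_max p v : Im (tangent_map S p v ord_max) = 0.
Proof. exact: Derive_const. Qed.

Lemma symplectic_sphere_section p v :
  symplectic_form (S p) (tangent_map S p v) = symplectic_form (f p) (tangent_map f p v).
Proof.
rewrite /symplectic_form big_ord_recr.
under eq_bigr do rewrite /S sphere_section_widen tangent_sphere_section_widen.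
by rewrite tangent_sphere_section_max /S sphere_section_max /=; ring.
Qed.

Lemma symplectic_tangent_sphere_section p v w :
  symplectic_form (tangent_map S p v) (tangent_map S p w) =
  symplectic_form (tangent_map f p v) (tangent_map f p w).
Proof.
rewrite /symplectic_form big_ord_recr.
under eq_bigr do rewrite !tangent_sphere_section_widen.
by rewrite !tangent_sphere_section_max /=; ring.
Qed.

End SphereSection.

(** The lift of an immersed isotropic torus in the ball, for any phase [t] on the
    torus that is a primitive of the pullback of tau. *)
Section LegendrianLift.

Context (f : R * R -> cvec 2) (t : R * R -> R).
Context (f_imm : immersed_torus f) (f1 : forall p, sqnorm (f p) < 1).
Context (f_iso : forall p v w,
  symplectic_form (tangent_map f p v) (tangent_map f p w) = 0).
Context (st : smooth_on (fun _ => True) t).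
Context (dt : forall p v, dir_derive t v p = tau (f p) (tangent_map f p v)).
Context (t_per : forall p q, same_torus_point p q -> t p = t q).

Let sf : smooth_map (fun _ => True) f := proj1 (proj2 f_imm).
Let sS := smooth_map_sphere_section f sf f1.
Let oT := @open_true (prod_NormedModule _ R_NormedModule R_NormedModule).
Let S1 : forall p, True -> sqnorm (sphere_section (f p)) = 1 :=
  fun p _ => sqnorm_sphere_section f f1 p.

Lemma torus_lift_immersed : immersed_torus (torus_lift f t).
Proof.
split=> [p q pq|].
  by rewrite /torus_lift (t_per p q pq) (proj1 f_imm p q pq).
split; first exact: smooth_map_rotate oT st sS.
move=> p _ v T0.
have {}T0 k : comb (dir_derive t v p) (itimes (sphere_section (f p))) 1
    (tangent_map (fun q => sphere_section (f q)) p v) k = RtoC 0.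
  apply: (phase_eq0 (t p)).
  exact: etrans (esym (tangent_rotate _ t _ p v oT st sS I k)) (T0 k).
have rho : 0 < sqrt (1 - sqnorm (f p)) by apply: sqrt_lt_R0; have := f1 p; lra.
(* The last coordinate of the section is [rho > 0] with real derivative, so the
   imaginary part of the last equation is [rho * dt v]. *)
have t0 : dir_derive t v p = 0.
  have := f_equal Im (T0 ord_max).
  rewrite /comb /itimes sphere_section_max.
  have := tangent_sphere_section_max f p v; rewrite /Im /= => -> e.
  apply: (Rmult_eq_reg_r (sqrt (1 - sqnorm (f p)))); lra.
apply: (proj2 (proj2 f_imm) p I) => k.
rewrite -tangent_sphere_section_widen -(T0 (widen_ord (leqnSn 2) k)) /comb t0.
by rewrite Cmult_0_l Cplus_0_l Cmult_1_l.
Qed.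

Theorem torus_lift_legendrian : legendrian_torus (torus_lift f t).
Proof.
split=> [|p|p v]; first exact: torus_lift_immersed.
  by rewrite -(S1 p I); exact: sqnorm_phase.
rewrite /contact_form.
have -> : rot_form (torus_lift f t p) (tangent_map (torus_lift f t) p v) = 0.
  apply: (rotate_legendrian _ t _ p v oT st sS S1 I).
  by rewrite dt (symplectic_sphere_section f p v).
by ring.
Qed.

Theorem torus_lift_lagrangian_cone : lagrangian_cone (torus_lift f t).
Proof.
apply: lagrangian_cone_of_legendrian torus_lift_legendrian _ => p v w.
apply: etrans (rotate_isotropic _ t _ p v w oT st sS S1 I) _.
by rewrite symplectic_tangent_sphere_section f_iso.
Qed.

Theorem torus_lift_lifts : lifts (torus_lift f t) f.
Proof.
move=> p.
have rho : 0 < sqrt (1 - sqnorm (f p)) by apply: sqrt_lt_R0; have := f1 p; lra.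
have cs := cos2_sin2 (t p).
have wE : torus_lift f t p ord_max = ((cos (t p), sin (t p)) * RtoC (sqrt (1 - sqnorm (f p))))%C.
  by [].
have e1 : Cmod (cos (t p), sin (t p)) = 1.
  by rewrite /Cmod /= !Rmult_1_r cs sqrt_1.
split.
  move=> w0; have : Cmod (torus_lift f t p ord_max) = 0 by rewrite w0 Cmod_0.
  by rewrite wE Cmod_mult e1 Cmod_R Rabs_right; lra.
move=> k; rewrite /hopf_ball wE Cmod_mult e1 Cmod_R Rabs_right; last lra.
rewrite /torus_lift sphere_section_widen Rmult_1_l.
set r := sqrt _ in rho *.
transitivity (RtoC ((cos (t p) * cos (t p) + sin (t p) * sin (t p)) * (r / r)) * f p k)%C.
  case: (f p k) => x y; rewrite /Cconj /Cdiv /Cinv /Cmult /RtoC /=; congr pair; field; lra.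
by rewrite cs Rmult_1_l Rdiv_diag; [ring | lra].
Qed.

End LegendrianLift.

(** * The area swept by a loop *)
Section Loops.

Definition area_density (g : R -> C) (x : R) : R :=
  Re (g x) * Derive (fun s => Im (g s)) x - Im (g x) * Derive (fun s => Re (g s)) x.

Definition sweep (g : R -> C) (x : R) : R := RInt (area_density g) 0 x.

Lemma periodic_Z {A : Type} (F : R -> A) :
  (forall x, F (x + 2 * PI) = F x) -> forall (k : Z) x, F (x + 2 * PI * IZR k) = F x.
Proof.
move=> per.
have pos (n : nat) x : F (x + 2 * PI * INR n) = F x.
  elim: n => [|n IH]; first by congr F; rewrite /=; ring.
  by rewrite S_INR -IH -[RHS]per; congr F; ring.
have IZR_pos k : IZR (Z.pos k) = INR (Pos.to_nat k).
  by rewrite INR_IZR_INZ positive_nat_Z.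
case=> [|k|k] x; first by congr F; ring.
  by rewrite (IZR_pos k) pos.
rewrite -(pos (Pos.to_nat k)) -Pos2Z.opp_pos opp_IZR (IZR_pos k).
by congr F; ring.
Qed.

Lemma Derive_periodic (f : R -> R) P :
  (forall x, f (x + P) = f x) -> forall x, Derive f (x + P) = Derive f x.
Proof.
move=> per x; rewrite -(Derive_ext (fun y => f (y + P)) f x per) /Derive.
congr (real _); apply: Lim_ext => h; congr (_ / _); congr (f _ - _); ring.
Qed.

Context (g : R -> C) (sg : smooth_immersed_loop g).

Lemma smooth_on_area_density :
  smooth_onR (fun _ => True) (area_density g).
Proof.
case: sg => _ dRe dIm _.
have oT := @open_true R_NormedModule.
apply: smooth_on_minus => //; apply: smooth_on_mult => //;
  by [exact: smooth_on_ex_derive_n | exact: smooth_on_derive].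
Qed.

Lemma continuous_area_density x : continuous (area_density g) x.
Proof. exact: smooth_on_continuous smooth_on_area_density I. Qed.

Lemma ex_RInt_area_density a b : ex_RInt (area_density g) a b.
Proof. by apply: ex_RInt_continuous => x _; exact: continuous_area_density. Qed.

Lemma is_derive_sweep x : is_derive (sweep g) x (area_density g x).
Proof.
apply: is_derive_RInt (continuous_area_density x).
by apply: filter_forall => y; apply: RInt_correct; exact: ex_RInt_area_density.
Qed.

Lemma smooth_on_sweep : smooth_onR (fun _ => True) (sweep g).
Proof.
apply: smooth_on_of_derivatives => [|x _|v]; first exact: open_true.
  by apply: ex_derive_continuous; exists (area_density g x); exact: is_derive_sweep.
exists (fun x => v * area_density g x).
  by apply: smooth_on_mult; [exact: open_true | apply: smooth_on_const; exact: open_true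
    | exact: smooth_on_area_density].
by apply: is_derive_line_derivative => x _; exact: is_derive_sweep.
Qed.

(** One full turn adds [net_area g]. *)
Lemma sweep_periodic : net_area g = 0 -> forall x, sweep g (x + 2 * PI) = sweep g x.
Proof.
case: sg => per _ _ _ g0 x.
have dper y : area_density g (y + 2 * PI) = area_density g y.
  rewrite /area_density per.
  by rewrite !Derive_periodic // => z; rewrite per.
rewrite /sweep -(RInt_Chasles _ 0 (2 * PI)); try exact: ex_RInt_area_density.
rewrite -[RInt _ 0 (2 * PI)]/(net_area g) g0 plus_zero_l.
have := RInt_comp_lin (area_density g) 1 (2 * PI) 0 x.
rewrite Rmult_0_r Rplus_0_l Rmult_1_l => <-; last exact: ex_RInt_area_density.
by apply: RInt_ext => y _; rewrite scal_one Rmult_1_l dper.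
Qed.

End Loops.

(** * Products of two loops *)
Section ProductTorus.

Context (g1 g2 : R -> C) (sg1 : smooth_immersed_loop g1) (sg2 : smooth_immersed_loop g2).

Let f := torus_map g1 g2.

Lemma tangent_torus_map p v :
  tangent_map f p v ord0 = (v.1 * Derive (fun s => Re (g1 s)) p.1,
                            v.1 * Derive (fun s => Im (g1 s)) p.1) /\
  tangent_map f p v ord_max = (v.2 * Derive (fun s => Re (g2 s)) p.2,
                               v.2 * Derive (fun s => Im (g2 s)) p.2).
Proof.
have D (phi : R -> R) x y : (forall k z, ex_derive_n phi k z) ->
    Derive (fun h => phi (line (V := R_NormedModule) x y h)) 0 = y * Derive phi x.
  move=> sphi; apply: is_derive_unique.
  apply: (is_derive_line_derivative (fun _ => True) phi (Derive phi) y) I => z _.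
  by apply: Derive_correct; exact: (sphi 1%N).
by case: sg1 sg2 => _ r1 i1 _ [_ r2 i2 _]; split; congr pair; apply: D.
Qed.

Lemma torus_map_immersed : immersed_torus f.
Proof.
case: (sg1) (sg2) => per1 r1 i1 imm1 [per2 r2 i2 imm2]; split.
  move=> p q [k [l ->]]; rewrite /f /torus_map /=.
  by rewrite (periodic_Z g1 per1) (periodic_Z g2 per2).
split=> [k|p _ v T0].
  have P1 phi : (forall k z, ex_derive_n phi k z) ->
      smooth_on (fun _ : R * R => True) (fun p => phi p.1).
    move=> sphi; apply: (smooth_on_linear _ (fun _ => True) fst) => //.
      exact: is_linear_fst.
    exact: smooth_on_ex_derive_n.
  have P2 phi : (forall k z, ex_derive_n phi k z) ->
      smooth_on (fun _ : R * R => True) (fun p => phi p.2).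
    move=> sphi; apply: (smooth_on_linear _ (fun _ => True) snd) => //.
      exact: is_linear_snd.
    exact: smooth_on_ex_derive_n.
  by case: (ord2_cases k) => ->; split;
    [exact: P1 r1 | exact: P1 i1 | exact: P2 r2 | exact: P2 i2].
have [T1 T2] := tangent_torus_map p v.
have nz (x a b : R) : (a, b) <> (0, 0) -> (x * a, x * b) = RtoC 0 -> x = 0.
  move=> ab [xa xb]; case: (Req_dec x 0) => // x0; case: ab.
  by congr pair; apply: (Rmult_eq_reg_l x); lra.
rewrite (surjective_pairing v); congr pair.
  by apply: (nz _ _ _ (imm1 p.1)); rewrite -T1 T0.
by apply: (nz _ _ _ (imm2 p.2)); rewrite -T2 T0.
Qed.

Lemma torus_map_isotropic p v w :
  symplectic_form (tangent_map f p v) (tangent_map f p w) = 0.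
Proof.
apply: big1 => k _; have [Tv1 Tv2] := tangent_torus_map p v.
have [Tw1 Tw2] := tangent_torus_map p w.
case: (ord2_cases k) => ->; first by rewrite Tv1 Tw1 /Re /Im /=; ring.
by rewrite Tv2 Tw2 /Re /Im /=; ring.
Qed.

Lemma sum2 (F : 'I_2 -> R) : \big[Rplus/0]_(k < 2) F k = F ord0 + F ord_max.
Proof.
rewrite 2!big_ord_recr big_ord0 /= Rplus_0_l.
by congr (F _ + _); exact: val_inj.
Qed.

(** The primitive, vanishing at [b], of the pullback of tau; the minus sign of tau
    is in the order of the differences. *)
Definition phase_function (b p : R * R) : R :=
  (sweep g1 b.1 - sweep g1 p.1) + (sweep g2 b.2 - sweep g2 p.2).

Lemma smooth_on_phase_function b : smooth_on (fun _ => True) (phase_function b).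
Proof.
have oT := @open_true (prod_NormedModule _ R_NormedModule R_NormedModule).
apply: smooth_on_plus => //; apply: smooth_on_minus => //; try exact: smooth_on_const.
  exact: (smooth_on_linear _ (fun _ => True) fst _ is_linear_fst (smooth_on_sweep g1 sg1)).
exact: (smooth_on_linear _ (fun _ => True) snd _ is_linear_snd (smooth_on_sweep g2 sg2)).
Qed.

Lemma phase_function_curve b (c1 c2 : R -> R) u d1 d2 :
  is_derive c1 u d1 -> is_derive c2 u d2 ->
  is_derive (fun h => phase_function b (c1 h, c2 h)) u
   (- (area_density g1 (c1 u) * d1 + area_density g2 (c2 u) * d2)).
Proof.
move=> dc1 dc2.
have D1 := is_derive_comp _ _ _ _ _ (is_derive_sweep g1 sg1 (c1 u)) dc1.
have D2 := is_derive_comp _ _ _ _ _ (is_derive_sweep g2 sg2 (c2 u)) dc2.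
have := is_derive_plus _ _ _ _ _ (is_derive_minus _ _ _ _ _ (is_derive_const (sweep g1 b.1) u) D1)
  (is_derive_minus _ _ _ _ _ (is_derive_const (sweep g2 b.2) u) D2).
rewrite /phase_function /=; set l := (X in is_derive _ _ X -> _).
have -> // : l = - (area_density g1 (c1 u) * d1 + area_density g2 (c2 u) * d2).
by rewrite /l /minus /plus /opp /zero /scal /= /mult /=; ring.
Qed.

Lemma dir_derive_phase_function b p v :
  dir_derive (phase_function b) v p = tau (f p) (tangent_map f p v).
Proof.
have L (x y : R) : is_derive (line (V := R_NormedModule) x y) 0 y.
  by rewrite /line /plus /scal /= /mult /=; auto_derive => //; ring.
rewrite /dir_derive.
apply: etrans (is_derive_unique _ _ _ (phase_function_curve b _ _ 0 _ _ (L p.1 v.1) (L p.2 v.2))) _.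
rewrite /tau /rot_form sum2; have [-> ->] := tangent_torus_map p v.
rewrite -[f p ord0]/(g1 p.1) -[f p ord_max]/(g2 p.2).
by rewrite !line0 /area_density /Re /Im /=; ring.
Qed.

Lemma phase_function_periodic b : net_area g1 = 0 -> net_area g2 = 0 ->
  forall p q, same_torus_point p q -> phase_function b p = phase_function b q.
Proof.
move=> A1 A2 p q [k [l ->]]; rewrite /phase_function /=.
rewrite (periodic_Z _ (sweep_periodic g1 sg1 A1)).
by rewrite (periodic_Z _ (sweep_periodic g2 sg2 A2)).
Qed.

Lemma tau_curve (c1 c2 : R -> R) u :
  ex_derive c1 u -> ex_derive c2 u ->
  tau (f (c1 u, c2 u)) (fun k => (Derive (fun h => Re (f (c1 h, c2 h) k)) u,
                                 Derive (fun h => Im (f (c1 h, c2 h) k)) u)) =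
  - (area_density g1 (c1 u) * Derive c1 u + area_density g2 (c2 u) * Derive c2 u).
Proof.
move=> dc1 dc2; case: sg1 sg2 => _ r1 i1 _ [_ r2 i2 _].
rewrite /tau /rot_form sum2 -[f _ ord0]/(g1 (c1 u)) -[f _ ord_max]/(g2 (c2 u)).
have D phi c : (forall k z, ex_derive_n phi k z) -> ex_derive c u ->
    Derive (fun h => phi (c h)) u = Derive c u * Derive phi (c u).
  by move=> sphi dc; apply: Derive_comp => //; exact: (sphi 1%N).
have -> := D _ c1 r1 dc1; have -> := D _ c1 i1 dc1.
have -> := D _ c2 r2 dc2; have -> := D _ c2 i2 dc2.
by rewrite /area_density /Re /Im /=; ring.
Qed.

(** The fundamental theorem of calculus on each piece.  The curve agrees with its
    smooth piece only on a closed interval, so its derivative is known only in the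
    interior, which is enough for the integral. *)
Lemma is_line_integral_piecewise b c : piecewise_C1 c ->
  is_line_integral tau (fun s => f (c s)) (phase_function b (c 1) - phase_function b (c 0)).
Proof.
move=> [m [s [q [s0 sm pieces]]]]; rewrite /is_line_integral.
set h := (X in is_RInt X).
suff H k : (k <= m)%N ->
    is_RInt h 0 (s k) (phase_function b (c (s k)) - phase_function b (c 0)).
  by have := H m (leqnn m); rewrite sm.
elim: k => [|k IH] km.
  by rewrite s0 Rminus_diag; exact: is_RInt_point.
have [lt_s cd1 cd2 cq] := pieces k km.
have -> : phase_function b (c (s k.+1)) - phase_function b (c 0) =
  plus (phase_function b (c (s k)) - phase_function b (c 0))
       (minus (phase_function b (c (s k.+1))) (phase_function b (c (s k)))).
  by rewrite /minus /plus /opp /=; ring.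
apply: is_RInt_Chasles (IH (ltnW km)) _.
pose dq u := - (area_density g1 (q k u).1 * Derive (fun u => (q k u).1) u
   + area_density g2 (q k u).2 * Derive (fun u => (q k u).2) u).
rewrite !cq; try lra.
apply: (is_RInt_ext dq).
  move=> u; rewrite Rmin_left ?Rmax_right; try lra; move=> u_in.
  rewrite /dq /h -tau_curve; [|by case: (cd1 u)|by case: (cd2 u)].
  have near_u : locally u (fun y => c y = q k y).
    have e0 : 0 < Rmin (u - s k) (s k.+1 - u) by apply: Rmin_pos; lra.
    exists (mkposreal _ e0) => y /= /Rabs_def2.
    rewrite /minus /plus /opp /= => -[y1 y2]; apply: cq.
    have := Rmin_l (u - s k) (s k.+1 - u); have := Rmin_r (u - s k) (s k.+1 - u).
    lra.
  rewrite cq; last lra; rewrite -surjective_pairing /tau; congr (- _).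
  apply: eq_bigr => j _ /=.
  have E (F : R * R -> R) : Derive (fun y => F ((q k y).1, (q k y).2)) u =
      Derive (fun y => F (c y)) u.
    apply: Derive_ext_loc; apply: filter_imp near_u => y ->.
    by rewrite -surjective_pairing.
  by rewrite (E (fun x => Re (f x j))) (E (fun x => Im (f x j))).
apply: (is_RInt_derive (fun u => phase_function b (q k u))) => u _.
  apply: (is_derive_ext (fun y => phase_function b ((q k y).1, (q k y).2))).
    by move=> y; rewrite -surjective_pairing.
  by apply: phase_function_curve; apply: Derive_correct; [case: (cd1 u) | case: (cd2 u)].
have cont g (c1 : R -> R) : smooth_immersed_loop g -> cont_diff c1 ->
    continuous (fun u => area_density g (c1 u) * Derive c1 u) u.
  move=> sg cd; have [dc cc] := cd u.
  apply: continuous_mult cc; apply: continuous_comp.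
    exact: ex_derive_continuous.
  exact: continuous_area_density.
by apply: continuous_opp; apply: continuous_plus; apply: cont.
Qed.

Lemma is_line_integral_phase_function b p c : net_area g1 = 0 -> net_area g2 = 0 ->
  torus_path b p c -> is_line_integral tau (fun s => f (c s)) (phase_function b p).
Proof.
move=> A1 A2 [pc cb cp].
have := is_line_integral_piecewise b c pc.
rewrite (phase_function_periodic b A1 A2 _ _ cb) (phase_function_periodic b A1 A2 _ _ cp).
by rewrite {2}/phase_function !Rminus_diag Rplus_0_r Rminus_0_r.
Qed.

End ProductTorus.

(** * Integrals over polygons, edge by edge *)
Section Polygon.

Context (N : nat) (N_gt0 : (0 < N)%N) (V : nat -> R * R).

Let R_gt0 : 0 < INR N.
Proof. by apply: lt_0_INR; apply/ltP. Qed.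

Definition edge_point (a b s : R) : R := (1 - s) * a + s * b.

Definition edge_param (k : nat) (theta : R) : R := INR N * theta / (2 * PI) - INR k.

Definition on_edge (k : nat) (theta : R) : Prop :=
  INR k * (2 * PI / INR N) < theta < INR k.+1 * (2 * PI / INR N).

Lemma polygon_on_edge k theta : (k < N)%N -> on_edge k theta ->
  polygon N V theta =
  (edge_point (V k).1 (V k.+1).1 (edge_param k theta),
   edge_point (V k).2 (V k.+1).2 (edge_param k theta)).
Proof.
move=> kN [lo hi]; have pi0 := PI_RGT_0.
have s_in : INR k < INR N * theta / (2 * PI) < INR k + 1.
  rewrite S_INR in hi.
  have E x : INR N / (2 * PI) * (x * (2 * PI / INR N)) = x by field; lra.
  have c0 : 0 < INR N / (2 * PI) by apply: Rdiv_lt_0_compat; lra.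
  have := Rmult_lt_compat_l _ _ _ c0 lo; have := Rmult_lt_compat_l _ _ _ c0 hi.
  rewrite !E => h1 h2.
  have -> : INR N * theta / (2 * PI) = INR N / (2 * PI) * theta by field; lra.
  by lra.
have [ip fp] := Int_part_frac_part_spec (INR N * theta / (2 * PI)) (Z.of_nat k)
  (edge_param k theta) ltac:(rewrite /edge_param; lra)
  ltac:(rewrite /edge_param -INR_IZR_INZ; ring).
rewrite /polygon -ip -fp Z.mod_small; last by move/ltP: kN; lia.
by rewrite Nat2Z.id.
Qed.

Lemma near_on_edge k theta : on_edge k theta -> locally theta (on_edge k).
Proof. by move=> te; apply: open_and te; [exact: open_gt | exact: open_lt]. Qed.

Lemma is_derive_edge a b k theta :
  is_derive (fun x => edge_point a b (edge_param k x)) theta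
    (INR N / (2 * PI) * (b - a)).
Proof.
have pi0 := PI_RGT_0; rewrite /edge_point /edge_param.
by auto_derive => //; field; lra.
Qed.

(** Each edge has parameter length [2 PI / N], hence the normalization of the
    constant value on it. *)
Lemma is_RInt_step (h : R -> R) (c : nat -> R) :
  (forall k, (k < N)%N -> forall theta, on_edge k theta -> h theta = INR N / (2 * PI) * c k) ->
  is_RInt h 0 (2 * PI) (\big[Rplus/0]_(k < N) c k).
Proof.
move=> hc; have pi0 := PI_RGT_0.
suff H m : (m <= N)%N ->
    is_RInt h 0 (INR m * (2 * PI / INR N)) (\big[Rplus/0]_(k < m) c k).
  have := H N (leqnn N); have -> // : INR N * (2 * PI / INR N) = 2 * PI.
  by field; lra.
elim: m => [|m IH] mN; first by rewrite big_ord0 Rmult_0_l; exact: is_RInt_point.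
rewrite big_ord_recr /=; apply: is_RInt_Chasles (IH (ltnW mN)) _.
have -> : c m = scal (INR m.+1 * (2 * PI / INR N) - INR m * (2 * PI / INR N))
    (INR N / (2 * PI) * c m).
  by rewrite S_INR /scal /= /mult /=; field; lra.
have lt_m : INR m * (2 * PI / INR N) <= INR m.+1 * (2 * PI / INR N).
  apply: Rmult_le_compat_r; last by rewrite S_INR; lra.
  by apply: Rlt_le; apply: Rdiv_lt_0_compat; lra.
apply: is_RInt_ext (is_RInt_const _ _ _) => x.
by rewrite Rmin_left // Rmax_right // => xm; rewrite (hc m mN x xm).
Qed.

(** On the edges of a grid diagram one of the two coordinates is constant.  This
    makes both integrands below constant on each edge. *)
Context (V_grid : forall k, (V k).1 = (V k.+1).1 \/ (V k).2 = (V k.+1).2).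

Lemma polygon_y_dx : y_dx (polygon N V) 0 (2 * PI) =
  \big[Rplus/0]_(k < N) ((V k).2 * ((V k.+1).1 - (V k).1)).
Proof.
apply: is_RInt_unique; apply: (is_RInt_step _ (fun k => (V k).2 * ((V k.+1).1 - (V k).1))).
move=> k kN theta te.
rewrite (_ : Derive _ _ = INR N / (2 * PI) * ((V k.+1).1 - (V k).1)).
  rewrite (polygon_on_edge _ _ kN te) /=; case: (V_grid k) => ->; first by ring.
  by rewrite /edge_point; ring.
apply: is_derive_unique; apply: is_derive_ext_loc (is_derive_edge _ _ k theta).
by apply: filter_imp (near_on_edge _ _ te) => x /(polygon_on_edge _ _ kN) ->.
Qed.

Lemma polygon_polar_area : net_area (fun theta => polar (polygon N V theta)) =
  \big[Rplus/0]_(k < N) ((V k).1 ^ 2 * ((V k.+1).2 - (V k).2)).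
Proof.
apply: is_RInt_unique; apply: (is_RInt_step _ (fun k => (V k).1 ^ 2 * ((V k.+1).2 - (V k).2))).
move=> k kN theta te.
pose r x := edge_point (V k).1 (V k.+1).1 (edge_param k x).
pose phi x := edge_point (V k).2 (V k.+1).2 (edge_param k x).
pose dr := INR N / (2 * PI) * ((V k.+1).1 - (V k).1).
pose dphi := INR N / (2 * PI) * ((V k.+1).2 - (V k).2).
have D1 : is_derive r theta dr := is_derive_edge _ _ k theta.
have D2 : is_derive phi theta dphi := is_derive_edge _ _ k theta.
have Dcos : is_derive (fun x => cos (phi x)) theta (dphi * - sin (phi theta)).
  exact: (is_derive_comp cos _ _ _ _ (is_derive_cos _) D2).
have Dsin : is_derive (fun x => sin (phi x)) theta (dphi * cos (phi theta)).
  exact: (is_derive_comp sin _ _ _ _ (is_derive_sin _) D2).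
have near_te := near_on_edge _ _ te.
rewrite (_ : Derive (fun s => Im _) _ =
    dr * sin (phi theta) + r theta * (dphi * cos (phi theta))); last first.
  apply: is_derive_unique.
  apply: is_derive_ext_loc (is_derive_mult _ _ _ _ _ D1 Dsin Rmult_comm).
  by apply: filter_imp near_te => x /(polygon_on_edge _ _ kN) ->.
rewrite (_ : Derive (fun s => Re _) _ =
    dr * cos (phi theta) + r theta * (dphi * - sin (phi theta))); last first.
  apply: is_derive_unique.
  apply: is_derive_ext_loc (is_derive_mult _ _ _ _ _ D1 Dcos Rmult_comm).
  by apply: filter_imp near_te => x /(polygon_on_edge _ _ kN) ->.
rewrite (polygon_on_edge _ _ kN te) /Re /Im /= -/(r theta) -/(phi theta).
transitivity ((r theta) ^ 2 * dphi *
    (cos (phi theta) * cos (phi theta) + sin (phi theta) * sin (phi theta))).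
  by ring.
rewrite cos2_sin2 /dphi; case: (V_grid k) => E.
  have -> : r theta = (V k).1 by rewrite /r /edge_point -E; ring.
  by ring.
by rewrite E; ring.
Qed.

End Polygon.

(** * Grid diagrams and their radial versions *)
Section Grid.

Context {n : nat} (G : grid n).

Lemma grid_size_gt0 : (0 < n)%N.
Proof. exact: leq_ltn_trans (leq0n _) (ltn_ord (start G)). Qed.

Lemma corner_edge k :
  (corner G k).1 = (corner G k.+1).1 \/ (corner G k).2 = (corner G k.+1).2.
Proof.
rewrite /corner /= uphalf_half; case: (odd k) => /=; last by left.
by right; rewrite /next_row permM permKV.
Qed.

(** The rows are visited in the order of a permutation with a single orbit, which
    returns to its start after [n] steps. *)
Lemma corner_period : corner G (2 * n) = corner G 0.
Proof.
rewrite /corner mul2n doubleK odd_double /=.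
have card_orbit : #|porbit (next_row G) (start G)| = n.
  rewrite -[RHS]card_ord; apply: eq_card => i; rewrite inE.
  exact: (one_loop G i).
have back := iter_porbit (next_row G) (start G); rewrite card_orbit in back.
by rewrite back.
Qed.

Lemma sum_telescope (F : nat -> R) m :
  \big[Rplus/0]_(k < m) (F k.+1 - F k) = F m - F 0%N.
Proof.
elim: m => [|m IH]; first by rewrite big_ord0; ring.
by rewrite big_ord_recr IH /=; ring.
Qed.

(** Both integrals weight the changes of column by an affine function of the row;
    since the changes sum to zero, the offset [1/2] of the cell centers drops out
    and only a proportionality factor is left. *)
Lemma radial_net_area : y_dx (grid_loop G) 0 (2 * PI) = 0 -> net_area (radial_loop G) = 0.
Proof.
have n0 := grid_size_gt0; have N0 : (0 < 2 * n)%N by rewrite muln_gt0.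
have Rn0 : 0 < INR n by apply: lt_0_INR; apply/ltP.
rewrite polygon_y_dx //; last first.
  by move=> k; case: (corner_edge k) => E;
    [right | left]; rewrite /cell_center; cbn [fst snd]; rewrite E.
rewrite polygon_polar_area //; last first.
  by move=> k; case: (corner_edge k) => E;
    [left | right]; rewrite /radial_vertex; cbn [fst snd]; rewrite E.
pose i k := INR (corner G k).1.+1; pose j k := INR (corner G k).2.+1.
(* the loop closes up, so the columns telescope *)
have tel : \big[Rplus/0]_(k < 2 * n) (j k.+1 - j k) = 0.
  by rewrite sum_telescope /j corner_period; ring.
have -> : \big[Rplus/0]_(k < 2 * n) ((cell_center (corner G k)).2 *
    ((cell_center (corner G k.+1)).1 - (cell_center (corner G k)).1)) =
    \big[Rplus/0]_(k < 2 * n) (i k * (j k.+1 - j k)).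
  transitivity (\big[Rplus/0]_(k < 2 * n) (i k * (j k.+1 - j k)) +
      - (1 / 2) * (\big[Rplus/0]_(k < 2 * n) (j k.+1 - j k))); last by rewrite tel; ring.
  rewrite sum_scal -big_split.
  apply: eq_bigr => k _.
  rewrite -[RHS]/(i k * (j k.+1 - j k) + - (1 / 2) * (j k.+1 - j k)).
  by rewrite /cell_center /i /j; cbn [fst snd]; ring.
move=> A0; transitivity (2 * PI / (3 * INR n * INR n) *
    (\big[Rplus/0]_(k < 2 * n) (i k * (j k.+1 - j k)))); last by rewrite A0; ring.
rewrite sum_scal; apply: eq_bigr => k _; rewrite /radial_vertex; cbn [fst snd].
rewrite pow2_sqrt -/(i k) -/(j k) -/(j k.+1); first by field; lra.
by apply: Rdiv_le_0_compat; [exact: pos_INR | lra].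
Qed.

Lemma radial_vertex_bound c : 0 <= (radial_vertex (n := n) c).1 <= sqrt (1 / 3).
Proof.
have Rn0 : 0 < INR n by apply: lt_0_INR; apply/ltP; exact: grid_size_gt0.
split; first exact: sqrt_pos.
apply: sqrt_le_1_alt; apply: (Rmult_le_reg_r (3 * INR n)); first lra.
have -> : INR c.1.+1 / (3 * INR n) * (3 * INR n) = INR c.1.+1 by field; lra.
have -> : 1 / 3 * (3 * INR n) = INR n by field.
by apply: le_INR; apply/leP; exact: ltn_ord.
Qed.

Lemma Cmod_radial_loop theta : Cmod (radial_loop G theta) <= sqrt (1 / 3).
Proof.
have Cmod_polar p : Cmod (polar p) = Rabs p.1.
  rewrite /polar /Cmod /= -sqrt_Rsqr_abs; congr sqrt.
  by rewrite !Rmult_1_r -[RHS]Rmult_1_l -(cos2_sin2 p.2) /Rsqr; ring.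
rewrite Cmod_polar /=.
set u := frac_part _; have [u0 u1] : u >= 0 /\ u < 1 := base_fp _.
set k := Z.to_nat _.
have := radial_vertex_bound (corner G k); have := radial_vertex_bound (corner G k.+1).
rewrite /=; set a := sqrt (_ / _); set b := sqrt (_ / _) => -[a0 a1] [b0 b1].
rewrite Rabs_right; nra.
Qed.

(** The radial diagram lies in the disk of radius [1 / sqrt 3 < 6/10], so a
    perturbation by less than [1/10] stays within [7/10 < 1 / sqrt 2].  This
    leaves each factor less than half of the unit available to the squared norm
    in the ball. *)
Lemma smoothing_radius g : smoothing G (1 / 10) g ->
  forall x, Re (g x) ^ 2 + Im (g x) ^ 2 < 1 / 2.
Proof.
move=> [_ [h _ close] _] x; have [lt_g _] := close x.
have tri := Cmod_triangle (g x - radial_loop G (h x)) (radial_loop G (h x)).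
have E : (g x - radial_loop G (h x) + radial_loop G (h x))%C = g x by ring.
rewrite E in tri.
have s3 : sqrt (1 / 3) < 6 / 10.
  rewrite -(sqrt_Rsqr (6 / 10)); last lra.
  by apply: sqrt_lt_1_alt; rewrite /Rsqr; lra.
have rad := Cmod_radial_loop (h x).
have g7 : Cmod (g x) < 7 / 10 by lra.
have := Cmod_ge_0 (g x); have := sqrt_sqrt (Re (g x) ^ 2 + Im (g x) ^ 2).
rewrite -[sqrt _]/(Cmod (g x)) => sq g0.
rewrite -sq; first by nra.
by apply: Rplus_le_le_0_compat; exact: pow2_ge_0.
Qed.

End Grid.

Theorem theorem4p20 (n1 n2 : nat) (G1 : grid n1) (G2 : grid n2)
    (HG1 : lagrangian_grid G1) (HG2 : lagrangian_grid G2) :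
  exists eps : R, 0 < eps /\
  forall g1 g2 : R -> C, smoothing G1 eps g1 -> smoothing G2 eps g2 ->
    let f := torus_map g1 g2 in
    immersed_torus f /\
    (forall p : R * R, sqnorm (f p) < 1) /\
    forall b : R * R, exists t : R * R -> R,
      (forall (p : R * R) (c : R -> R * R), torus_path b p c ->
         is_line_integral tau (fun s => f (c s)) (t p)) /\
      lifts (torus_lift f t) f /\
      legendrian_torus (torus_lift f t) /\
      lagrangian_cone (torus_lift f t).
Proof.
exists (1 / 10); split; first lra.
move=> g1 g2 S1 S2 f; have [sg1 _ A1] := S1; have [sg2 _ A2] := S2.
rewrite (radial_net_area G1 (proj1 HG1)) in A1.
rewrite (radial_net_area G2 (proj1 HG2)) in A2.
have f_imm : immersed_torus f by exact: torus_map_immersed.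
have f1 p : sqnorm (f p) < 1.
  rewrite /sqnorm sum2 -[f p ord0]/(g1 p.1) -[f p ord_max]/(g2 p.2).
  by have := smoothing_radius G1 g1 S1 p.1; have := smoothing_radius G2 g2 S2 p.2; lra.
have f_iso := torus_map_isotropic g1 g2 sg1 sg2.
split=> //; split=> // b; exists (phase_function g1 g2 b).
have st := smooth_on_phase_function g1 g2 sg1 sg2 b.
have dt := dir_derive_phase_function g1 g2 sg1 sg2 b.
have t_per := phase_function_periodic g1 g2 sg1 sg2 b A1 A2.
split=> [p c|]; first exact: is_line_integral_phase_function.
split; first exact: torus_lift_lifts.
split; first exact: torus_lift_legendrian.
exact: torus_lift_lagrangian_cone.
Qed.
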